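(* Let $\mathbb{G}$ be a countable amenable finitely generated torsion-free group, let $X$ be a $\mathbb{G}$-subshift, let $\mu$ be a measure of maximal entropy of $X$, let $F\subset\mathbb{G}$ be finite, and let $v,w\in L_F(X)$. If $E_X(v)\subseteq E_X(w)$, then $$\mu(v)\leq\mu(w).$$
   Context: Let $\mathcal{A}$ be a finite alphabet and give $\mathcal{A}^{\mathbb{G}}$ the product topology. $\mathbb{G}$ acts by left translations $(\sigma_g x)_h=x_{g^{-1}h}$. A $\mathbb{G}$-subshift is a (nonempty) closed set $X\subseteq\mathcal{A}^{\mathbb{G}}$ with $\sigma_g(X)=X$ for all $g\in\mathbb{G}$. For finite $F\subset\mathbb{G}$, $L_F(X)=\{x_F:x\in X\}\subseteq\mathcal{A}^F$, where $x_F$ is the restriction of $x$ to $F$. For $w\in L_F(X)$, $[w]=\{x\in X:x_F=w\}$, and the extender set is $E_X(w)=\{x|_{F^c}:x\in[w]\}\subseteq\mathcal{A}^{F^c}$, where $F^c=\mathbb{G}\setminus F$. A Følner sequence is a sequence of nonempty finite sets $F_n\subset\mathbb{G}$ with $|(F_n\cdot K)\,\Delta\, F_n|/|F_n|\to 0$ for every nonempty finite $K\subset\mathbb{G}$; $\mathbb{G}$ is amenable if one exists. Torsion-free means that no nonidentity element has finite order. The topological entropy is $h_{top}(X)=\lim_n\frac1{|F_n|}\log|L_{F_n}(X)|$. Measures are Borel probability measures on $X$ invariant under all $\sigma_g$; $\mu(w):=\mu([w])$; the entropy is $h_\mu(X)=\lim_n\frac1{|F_n|}\sum_{w\in\mathcal{A}^{F_n}}-\mu(w)\log\mu(w)$.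 Both limits are independent of the Følner sequence. $\mu$ is a measure of maximal entropy if $h_\mu(X)=h_{top}(X)$. *)

(* Defs.v *)
From HB Require Import structures.
From mathcomp Require Import all_boot all_order all_algebra finmap.
From mathcomp Require Import all_classical all_reals all_analysis.

Set Implicit Arguments.
Unset Strict Implicit.
Unset Printing Implicit Defensive.
Import Order.TTheory GRing.Theory Num.Theory numFieldNormedType.Exports.

Local Open Scope classical_set_scope.
Local Open Scope ring_scope.

(* [group_closed H] says that [H] is a subgroup of [G]. *)
Definition finitely_generated (G : groupType) : Prop :=
  exists S : {fset G}, forall H : {pred G},
    group_closed H -> {subset S <= H} -> forall g : G, g \in H.

Definition torsion_free (G : groupType) : Prop :=
  forall (g : G) (n : nat), g != 1%g -> (0 < n)%N -> (g ^+ n)%g != 1%g.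

Definition symdiff (T : choiceType) (B C : {fset T}) : {fset T} :=
  ((B `\` C) `|` (C `\` B))%fset.

Definition mulfset (G : groupType) (B C : {fset G}) : {fset G} :=
  [fset (b * c)%g | b in B, c in C]%fset.

Definition folner (R : realType) (G : groupType) (F : nat -> {fset G}) : Prop :=
  (forall n, F n != fset0) /\
  forall K : {fset G}, K != fset0 ->
    #|` symdiff (mulfset (F n) K) (F n) |%:R / #|` F n |%:R @[n --> \oo]
      --> (0 : R).

(* The choice of [R] is immaterial: it is only where the ratios are read. *)
Definition amenable (R : realType) (G : groupType) : Prop :=
  exists F : nat -> {fset G}, folner R F.

Notation config G A := {ptws G -> discrete_topology A}.

Definition translate (G : groupType) (A : finType) (g : G) (x : config G A) :
    config G A :=
  fun h => x (g^-1 * h)%g.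

Record subshift (G : groupType) (A : finType) := Subshift {
  subshift_set :> set (config G A);
  subshift_neq0 : subshift_set !=set0;
  subshift_closed : closed subshift_set;
  subshift_translate : forall g, translate g @` subshift_set = subshift_set }.

Section patterns.
Variables (G : groupType) (A : finType).

Definition pattern (F : {fset G}) (x : config G A) : {ffun F -> A} :=
  [ffun i : F => x (val i)].

Definition outer_pattern (F : {fset G}) (x : config G A) :
    {g : G | g \notin F} -> A :=
  fun i => x (val i).

Definition language (X : subshift G A) (F : {fset G}) : {set {ffun F -> A}} :=
  [set w : {ffun F -> A} | `[< exists2 x, subshift_set X x & pattern F x = w >]]%SET.

Definition extender_set (X : subshift G A) (F : {fset G}) (w : {ffun F -> A}) :
    set ({g : G | g \notin F} -> A) :=
  outer_pattern (F := F) @` [set x | subshift_set X x /\ pattern F x = w].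

End patterns.

(* [points X] is [X] as a type, with the subspace topology. The alias is there
   to carry a [Pointed] instance, which measurable types require and which
   [set_type] only has for nonempty sets. *)
Definition points (G : groupType) (A : finType) (X : subshift G A) : Type :=
  set_type X.

HB.instance Definition _ (G : groupType) (A : finType) (X : subshift G A) :=
  Topological.copy (points X) (set_type X).

Section points.
Variables (G : groupType) (A : finType) (X : subshift G A).

Definition config_of (x : points X) : config G A := set_val x.

Lemma points_ex : exists x : points X, True.
Proof.
by have [x Xx] := subshift_neq0 X; exists (exist _ x (mem_set Xx)).
Qed.

HB.instance Definition _ :=
  isPointed.Build (points X) (projT1 (cid points_ex)).

Lemma translate_mem (g : G) (x : points X) :
  translate g (config_of x) \in (X : set (config G A)).
Proof.
apply/mem_set; rewrite -(subshift_translate X g).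
by exists (config_of x) => //; exact: set_mem (valP x).
Qed.

Definition translate_points (g : G) (x : points X) : points X :=
  exist _ (translate g (config_of x)) (translate_mem g x).

Definition borel := g_sigma_algebraType (@open (points X)).

Definition cylinder (F : {fset G}) (w : {ffun F -> A}) : set borel :=
  [set x | pattern F (config_of x) = w].

End points.

Arguments cylinder {G A} X {F} w _.

Section entropy.
Variables (R : realType) (G : groupType) (A : finType) (X : subshift G A).

Definition translation_invariant (mu : probability (borel X) R) : Prop :=
  forall (g : G) (B : set (borel X)), measurable B ->
    mu (translate_points g @^-1` B) = mu B.

Definition shannon (mu : probability (borel X) R) (F : {fset G}) : R :=
  \sum_(w : {ffun F -> A})
    - (fine (mu (cylinder X w)) * ln (fine (mu (cylinder X w)))).

Definition topological_entropy (F : nat -> {fset G}) (h : R) : Prop :=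
  (#|` F n |%:R)^-1 * ln #|language X (F n)|%:R @[n --> \oo] --> h.

Definition measure_entropy (mu : probability (borel X) R)
    (F : nat -> {fset G}) (h : R) : Prop :=
  (#|` F n |%:R)^-1 * shannon mu (F n) @[n --> \oo] --> h.

(* Neither limit depends on the Folner sequence, so that a single sequence is
   enough to say that the two entropies are equal. *)
Definition maximal_entropy (mu : probability (borel X) R) : Prop :=
  translation_invariant mu /\
  exists F : nat -> {fset G}, folner R F /\
    exists h : R, measure_entropy mu F h /\ topological_entropy F h.

End entropy.

(* Main.v *)
Require Import Defs.
From mathcomp Require Import all_boot all_order all_algebra finmap.
From mathcomp Require Import all_classical all_reals all_analysis.
From mathcomp Require Import ring lra.

(** Let E be a large Folner set, and for a word u on E in the language L let
    M(u) be the number of occurrences of v in u minus that of w. Invariance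
    gives that the mu-average of M is close to |E| (mu(v) - mu(w)). On the
    other hand the inclusion of extender sets allows any v to be replaced by
    w, and because of this the average of M over all words of L, counted alike,
    is not positive. If mu(v) > mu(w), mu is therefore biased towards words
    with many v's; such a bias costs entropy, in an amount proportional to |E|,
    and this is impossible for a measure of maximal entropy.

    The cost is computed by tilting the uniform measure on L: let q_t be the
    probability proportional to exp(t M). Two applications of the Gibbs
    inequality, to (mu, q_t) and to (q_t, uniform), give
      H(mu) + t E_mu(M) <= log (sum of exp(t M)) <= log |L| + t E_{q_t}(M).
    It remains to see that E_{q_t}(M) is small relative to |E|. Replacing the
    v that occurs at g by w is an injection, from the pairs (u, g) where v
    occurs in u at g to the pairs where w does; and it changes M by at most
    2 |F|^2, because only occurrences that meet gF are affected. Hence the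
    weights of the two families of pairs almost cancel, and
      E_{q_t}(M) <= |E| (exp(2 |F|^2 t) - 1)
    (tilted_excess_le). Altogether
      H(mu) + t E_mu(M) <= log |L| + t |E| (exp(2 |F|^2 t) - 1)
    (entropy_excess_le, shannon_excess_le). After division by |E|, the entropy
    terms cancel in the limit, and what is left is
    mu(v) - mu(w) <= 2 (exp(2 |F|^2 t) - 1), which fails when t is small. The
    factor 2 leaves room for the boundary of E (folner_interior).

    The estimate concerns averages over mu, so that it applies directly to
    measures that are not ergodic. *)

Set Implicit Arguments.
Unset Strict Implicit.
Unset Printing Implicit Defensive.
Import Order.TTheory GRing.Theory Num.Theory numFieldNormedType.Exports.

Local Open Scope classical_set_scope.
Local Open Scope ring_scope.

(** * Entropy of a distribution on finitely many words *)

Section finite_entropy.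
Variables (R : realType) (U : finType).

(** Nonnegativity of the relative entropy of [p] with respect to [q]; the
    right-hand side accounts for [q] not being normalized. It holds term by
    term, by [ln y <= y - 1] at [y = q u / (Q * p u)], once the terms
    [q u / Q - p u] of total zero are added. *)
Lemma gibbs_inequality (L : {set U}) (p q : U -> R) :
    (forall u, 0 <= p u) -> \sum_(u in L) p u = 1 ->
    (forall u, u \in L -> 0 < q u) ->
  \sum_(u in L) - (p u * ln (p u)) + \sum_(u in L) p u * ln (q u)
    <= ln (\sum_(u in L) q u).
Proof.
move=> p0 p1 q0; set Q := \sum_(u in L) q u.
have [u0 u0L] : exists u, u \in L.
  apply/set0Pn; apply/eqP => L0; move: p1; rewrite L0 big_set0.
  by move/eqP; rewrite eq_sym oner_eq0.
have Q0 : 0 < Q.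
  rewrite /Q (bigD1 u0) //= ltr_pwDl ?q0//.
  by apply: sumr_ge0 => u /andP[uL _]; exact/ltW/q0.
have term u : u \in L ->
    - (p u * ln (p u)) + p u * ln (q u) <= p u * ln Q + (q u / Q - p u).
  move=> uL; have [->|pn0] := eqVneq (p u) 0.
    rewrite !mul0r oppr0 !add0r addr0.
    by rewrite divr_ge0// ltW// q0.
  have pu : 0 < p u by rewrite lt_neqAle eq_sym pn0 p0.
  have y0 : 0 < q u / (Q * p u) by rewrite divr_gt0 ?q0 ?mulr_gt0.
  have : ln (q u / (Q * p u)) <= q u / (Q * p u) - 1.
    by rewrite -{1}(subrK 1 (q u / _)) addrC le_ln1Dx//; lra.
  rewrite ln_div ?posrE ?q0 ?mulr_gt0// lnM ?posrE// => le1.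
  have -> : q u / Q - p u = p u * (q u / (Q * p u) - 1).
    by field; rewrite pn0 gt_eqF.
  have := ler_wpM2l (p0 u) le1; rewrite mulrBr mulrDr; lra.
rewrite -big_split/=; apply: le_trans (ler_sum _ term) _.
rewrite big_split/= -mulr_suml p1 mul1r sumrB p1 -mulr_suml divff ?gt_eqF//.
by rewrite subrr addr0.
Qed.

(** [D] is the set of positions, [V u] and [W u] are those at which the patterns
    v and w occur in the word [u], and [exchange u g] is [u] with the v at [g]
    replaced by w. *)
Variables (D : finType) (L : {set U}) (V W : U -> {set D}).
Variables (exchange : U -> D -> U) (C : nat).

Let excess u : R := #|V u|%:R - #|W u|%:R.

Hypothesis exchangeL : forall u g, u \in L -> g \in V u -> exchange u g \in L.
Hypothesis exchangeW : forall u g, g \in V u -> g \in W (exchange u g).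
Hypothesis exchange_inj : forall g u1 u2, g \in V u1 -> g \in V u2 ->
  exchange u1 g = exchange u2 g -> u1 = u2.
Hypothesis exchangeV_card : forall u g, g \in V u ->
  (#|V u| <= #|V (exchange u g)| + C)%N.
Hypothesis exchangeW_card : forall u g, g \in V u ->
  (#|W (exchange u g)| <= #|W u| + C)%N.

(** The left-hand side is the difference of two sums of the weights
    [expR (t * excess u)], one over the pairs [(u, g)] with [g \in V u] and one
    over those with [g \in W u]. For each [g], [exchange] injects the first
    family into the second and divides the weight by at most
    [expR (t * C.*2)], so that only [expR (t * C.*2) - 1] times the second sum
    can remain. *)
Lemma tilted_excess_le (t : R) : 0 <= t ->
  \sum_(u in L) excess u * expR (t * excess u) <=
  #|D|%:R * (expR (t * (C.*2)%:R) - 1) * \sum_(u in L) expR (t * excess u).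
Proof.
move=> t0; set z := expR (t * _).
have z1 : 1 <= z by rewrite -expR0 ler_expR mulr_ge0.
have VW : \sum_(u in L) #|V u|%:R * expR (t * excess u) <=
          \sum_(u in L) #|W u|%:R * (expR (t * excess u) * z).
  have cardE (B : {set D}) (c : R) : #|B|%:R * c = \sum_(g in B) c.
    by rewrite sumr_const mulr_natl.
  under eq_bigr do rewrite cardE.
  under [leRHS]eq_bigr do rewrite cardE.
  rewrite [leLHS](exchange_big_dep predT)//= [leRHS](exchange_big_dep predT)//=.
  apply: ler_sum => g _.
  have le1 u : (u \in L) && (g \in V u) ->
      expR (t * excess u) <= expR (t * excess (exchange u g)) * z.
    move=> /andP[uL gV]; rewrite -expRD ler_expR -mulrDr ler_wpM2l//.
    have := exchangeV_card gV; have := exchangeW_card gV.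
    rewrite -2!(ler_nat R) !natrD -addnn natrD /excess; lra.
  apply: le_trans (ler_sum _ le1) _.
  pose S := [set u in L | g \in V u].
  have SE u : (u \in L) && (g \in V u) = (u \in S) by rewrite inE.
  rewrite (eq_bigl _ _ SE).
  rewrite -(big_imset (h := exchange^~ g) (A := S)
    (fun u => expR (t * excess u) * z))/=; last first.
    move=> u1 u2; rewrite !inE => /andP[_ g1] /andP[_ g2].
    exact: exchange_inj.
  rewrite [leRHS](bigID [in [set exchange u g | u in S]%SET])/=.
  rewrite -[leLHS]addr0 lerD//; last first.
    by apply: sumr_ge0 => u _; rewrite mulr_ge0 ?expR_ge0.
  rewrite le_eqVlt; apply/orP; left; apply/eqP; apply: eq_bigl => u.
  rewrite andbC; case: imsetP => [[u' u'S ->]|//]/=.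
  by move: u'S; rewrite inE => /andP[uL gV]; rewrite exchangeL//= exchangeW.
under eq_bigr do rewrite /excess mulrBl.
rewrite sumrB lerBlDr; apply: le_trans VW _.
rewrite mulr_sumr -big_split/=; apply: ler_sum => u _.
have : #|W u|%:R * ((z - 1) * expR (t * excess u)) <=
       #|D|%:R * ((z - 1) * expR (t * excess u)).
  by rewrite ler_wpM2r ?ler_nat ?max_card// mulr_ge0 ?expR_ge0 ?subr_ge0.
by rewrite -/(excess u); move: (expR _) => e; lra.
Qed.

(** A distribution of nearly maximal entropy on [L] cannot have a large expected
    excess, since the tilted distribution, which maximizes entropy plus [t]
    times expected excess, has a small one. *)
Theorem entropy_excess_le (p : U -> R) (t : R) : 0 <= t ->
    (forall u, 0 <= p u) -> \sum_(u in L) p u = 1 ->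
  \sum_(u in L) - (p u * ln (p u)) + t * \sum_(u in L) p u * excess u <=
  ln #|L|%:R + t * (#|D|%:R * (expR (t * (C.*2)%:R) - 1)).
Proof.
move=> t0 p0 p1; pose q u := expR (t * excess u).
pose Z := \sum_(u in L) q u.
have q0 u : u \in L -> 0 < q u by rewrite expR_gt0.
(* The tilted weights bound the left-hand side by ln Z. *)
have := gibbs_inequality p0 p1 q0.
under [X in _ + X <= _]eq_bigr do rewrite expRK mulrCA.
rewrite -mulr_sumr -/Z => /le_trans; apply.
have [u0 u0L] : exists u, u \in L.
  apply/set0Pn; apply/eqP => L0; move: p1; rewrite L0 big_set0.
  by move/eqP; rewrite eq_sym oner_eq0.
have Z0 : 0 < Z.
  rewrite /Z (bigD1 u0) //= ltr_pwDl ?q0//.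
  by apply: sumr_ge0 => u /andP[uL _]; exact/ltW/q0.
have qZ1 : \sum_(u in L) q u / Z = 1 by rewrite -mulr_suml divff ?gt_eqF.
have qZ0 u : 0 <= q u / Z by rewrite divr_ge0 ?expR_ge0 ?ltW.
(* The entropy of the tilted distribution is at most that of the uniform one. *)
have := gibbs_inequality (q := fun=> 1) qZ0 qZ1 (fun _ _ => ltr01).
under [X in _ + X <= _]eq_bigr do rewrite ln1 mulr0.
rewrite big1_eq addr0 sumr_const.
have -> : \sum_(u in L) - (q u / Z * ln (q u / Z)) =
    ln Z - t * ((\sum_(u in L) excess u * q u) / Z).
  rewrite -[X in X - _]mul1r -{1}qZ1 !mulr_suml mulr_sumr -sumrB.
  apply: eq_bigr => u uL.
  by rewrite ln_div ?posrE ?q0// /q expRK; ring.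
rewrite lerBlDr => /le_trans; apply; rewrite lerD2l ler_wpM2l//.
by rewrite ler_pdivrMr// tilted_excess_le.
Qed.

End finite_entropy.

(** * Occurrences of a pattern in a word, and their replacement *)

Section occurrences.
Variables (G : groupType) (A : finType) (E F : {fset G}).
Implicit Types (v w : {ffun F -> A}) (u : {ffun E -> A}).

(** The [insub] makes [g * F] contained in [E] part of an occurrence at [g]. *)
Definition occurrences v u : {set E} :=
  [set g : E | [forall i : F, omap u (insub (val g * val i)%g) == Some (v i)]].

Definition overwrite w (g : G) u : {ffun E -> A} :=
  [ffun h : E => oapp w (u h) (insub (g^-1 * val h)%g)].

Lemma occurrencesP v u (g : E) :
  reflect (forall i : F, exists2 h : E, val h = (val g * val i)%g & u h = v i)
          (g \in occurrences v u).
Proof.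
rewrite inE; apply: (iffP forallP) => occ i.
  move: (occ i); case: insubP => //= h _ hE /eqP[uh].
  by exists h.
have [h hE uh] := occ i; rewrite -hE; case: insubP => [h' _ /val_inj ->|] /=.
  by rewrite uh.
by rewrite fsvalP.
Qed.

Lemma overwrite_in w (g : G) u (h : E) (i : F) :
  val h = (g * val i)%g -> overwrite w g u h = w i.
Proof.
move=> hE; rewrite ffunE hE mulKg; case: insubP => [j _ /val_inj -> //|].
by rewrite fsvalP.
Qed.

Lemma overwrite_out w (g : G) u (h : E) :
  (g^-1 * val h)%g \notin F -> overwrite w g u h = u h.
Proof. by move=> hF; rewrite ffunE insubN. Qed.

Lemma occurrences_overwrite v w u (g : E) :
  g \in occurrences v u -> g \in occurrences w (overwrite w (val g) u).
Proof.
move=> /occurrencesP occ; apply/occurrencesP => i.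
by have [h hE _] := occ i; exists h => //; exact: overwrite_in.
Qed.

Lemma overwrite_inj v w (g : E) u1 u2 :
    g \in occurrences v u1 -> g \in occurrences v u2 ->
  overwrite w (val g) u1 = overwrite w (val g) u2 -> u1 = u2.
Proof.
move=> /occurrencesP occ1 /occurrencesP occ2 eq12; apply/ffunP => h.
have [hF|hF] := boolP (((val g)^-1 * val h)%g \in F).
  have [h1 /[!mulVKg] /val_inj h1E u1v] := occ1 [` hF]%fset.
  have [h2 /[!mulVKg] /val_inj h2E u2v] := occ2 [` hF]%fset.
  by rewrite -{1}h1E -h2E u1v u2v.
by rewrite -(overwrite_out w u1 hF) eq12 overwrite_out.
Qed.

(** Words that agree off [g * F] differ only in the occurrences at positions
    [g'] such that [g' * F] meets [g * F]; such a [g'] is [g * j * i^-1] for some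
    [i] and [j] in [F]. *)
Lemma occurrences_card_le v u u' (g : G) :
    (forall h : E, (g^-1 * val h)%g \notin F -> u h = u' h) ->
  (#|occurrences v u| <= #|occurrences v u'| + #|` F| * #|` F|)%N.
Proof.
move=> uu'; pose f (ij : F * F) := (g * val ij.2 * (val ij.1)^-1)%g.
pose near := [set g' : E | val g' \in codom f]%SET.
have near_card : (#|near| <= #|` F| * #|` F|)%N.
  rewrite !cardfE -card_prod cardE -(size_map val) -(size_codom f).
  apply: uniq_leq_size; last first.
    by move=> _ /mapP[g' + ->]; rewrite mem_enum inE.
  by rewrite map_inj_uniq ?enum_uniq//; exact: val_inj.
have sub : occurrences v u \subset occurrences v u' :|: near.
  apply/fintype.subsetP => g' /occurrencesP occ; rewrite finset.in_setU orbC.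
  have [//|far] := boolP (g' \in near); apply/occurrencesP => i.
  have [h hE uh] := occ i; exists h => //; rewrite -uu' //.
  apply: contra far => hF; rewrite inE; apply/codomP.
  by exists (i, [` hF]%fset); rewrite /f/= mulVKg hE mulgK.
apply: leq_trans (subset_leq_card sub) _.
by rewrite (leq_trans (leq_card_setU _ _))// leq_add2l.
Qed.

End occurrences.

(** Bringing the occurrence back to [F] by a translation, the rest of the
    configuration is in the extender set of [v], hence also extends [w]. *)
Lemma overwrite_language (G : groupType) (A : finType) (X : subshift G A)
    (E F : {fset G}) (v w : {ffun F -> A}) (u : {ffun E -> A}) (g : E) :
    extender_set X v `<=` extender_set X w ->
    u \in language X E -> g \in occurrences v u ->
  overwrite w (val g) u \in language X E.
Proof.
move=> vw uL /occurrencesP occ; move: uL.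
rewrite !inE => -[x Xx xu].
have transX (a : G) y : subshift_set X y -> subshift_set X (translate a y).
  by move=> Xy; rewrite -(subshift_translate X a); exists y.
pose y := translate (val g)^-1%g x.
have yv : pattern F y = v.
  apply/ffunP => i; have [h hE <-] := occ i.
  by rewrite ffunE /y /translate invgK -hE -xu ffunE.
have [|z [Xz zw] zy] := vw (outer_pattern y).
  by exists y => //; split => //; exact: transX.
exists (translate (val g) z); first exact: transX.
apply/ffunP => h; rewrite ffunE /translate.
have [hF|hF] := boolP (((val g)^-1 * val h)%g \in F).
  rewrite (overwrite_in w u (i := [` hF]%fset)) ?mulVKg//.
  by rewrite -zw ffunE.
rewrite overwrite_out//.
have := congr1 (@^~ (exist (fun g => g \notin F) _ hF)) zy.
rewrite /outer_pattern/= => ->.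
by rewrite /y /translate invgK mulVKg -xu ffunE.
Qed.

(** * Interiors of Folner sets *)

Section interior.
Variables (G : groupType).

Definition interior_set (E F : {fset G}) : {set E} :=
  [set g : E | [forall i : F, (val g * val i)%g \in E]].

(** Each position off the interior is sent out of [E] by some [i] in [F], and
    right multiplication by [i] is injective. *)
Lemma card_interior_set (E F K : {fset G}) : {subset F <= K} ->
  (#|` E| <= #|interior_set E F| + #|` F| * #|` symdiff (mulfset E K) E|)%N.
Proof.
move=> FK; rewrite [#|` E|]cardfE -(cardsC (interior_set E F)) leq_add2l.
pose out (i : F) := [set g : E | (val g * val i)%g \notin E]%SET.
have sub : ~: interior_set E F \subset (\bigcup_(i : F) out i)%SET.
  apply/fintype.subsetP => g; rewrite !inE negb_forall => /existsP[i gi].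
  by apply/finset.bigcupP; exists i => //; rewrite inE.
apply: leq_trans (subset_leq_card sub) _.
have out_card (i : F) : (#|out i| <= #|` symdiff (mulfset E K) E|)%N.
  rewrite cardE -(size_map (fun g : E => (val g * val i)%g)).
  apply: uniq_leq_size.
    by rewrite map_inj_uniq ?enum_uniq// => g h /mulIg/val_inj.
  move=> _ /mapP[g + ->]; rewrite mem_enum inE => gi.
  rewrite in_fsetU in_fsetD gi/=; apply/orP; left.
  apply/imfset2P; exists (val g); rewrite ?fsvalP//.
  by exists (val i) => //; apply/FK/fsvalP.
rewrite [#|` F|]cardfE -sum_nat_const.
apply: (@leq_trans (\sum_(i : F) #|out i|)); last exact: leq_sum.
elim/big_ind2: _ => [|s1 B1 s2 B2 h1 h2|//]; first by rewrite cards0.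
by rewrite (leq_trans (leq_card_setU _ _))// leq_add.
Qed.

End interior.

Lemma folner_interior (R : realType) (G : groupType) (E : nat -> {fset G})
    (F : {fset G}) : folner R E ->
  \forall n \near \oo, #|` E n|%:R <= 2 * #|interior_set (E n) F|%:R :> R.
Proof.
move=> [E0 EK].
(* The identity is added because [F] may be empty. *)
pose K := (1%g |` F)%fset.
have K0 : K != fset0 by apply/fset0Pn; exists 1%g; exact: fset1U1.
have FK : {subset F <= K} by move=> g gF; exact: fset1Ur.
pose e : R := (2 * #|` F|.+1%:R)^-1.
have e0 : 0 < e by rewrite invr_gt0 mulr_gt0.
have /cvgrPdist_lt/(_ e e0) := EK K K0; apply: filterS => n.
have En : 0 < #|` E n|%:R :> R by rewrite ltr0n cardfs_gt0.
rewrite sub0r normrN ger0_norm ?divr_ge0 ?ler0n// ltr_pdivrMr//.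
rewrite /e mulrC ltr_pdivlMr ?mulr_gt0// => small.
have := card_interior_set (E n) FK; rewrite -(ler_nat R) natrD natrM.
move: small; rewrite -natr1; set s := _%:R; set f := _%:R.
have s0 : 0 <= s by exact: ler0n.
lra.
Qed.

(** * Pattern probabilities *)

Section pattern_probability.
Variables (R : realType) (G : groupType) (A : finType) (X : subshift G A).

Lemma config_translate (g h : G) (x : points X) :
  config_of (translate_points g x) h = config_of x (g^-1 * h)%g.
Proof. by []. Qed.

Lemma measurable_cylinder (E : {fset G}) (u : {ffun E -> A}) :
  measurable (cylinder X u).
Proof.
have -> : cylinder X u =
    \bigcap_(i in [set: E]) [set x : borel X | config_of x (val i) = u i].
  apply/seteqP; split => [x/= <- i _|x /= xu]; first by rewrite /= ffunE.
  by apply/ffunP => i; rewrite ffunE; exact: xu.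
apply: fin_bigcap_measurable => // i _; apply: sub_sigma_algebra.
have /continuousP pr :
    continuous (proj (val i) : config G A -> discrete_topology A).
  exact: proj_continuous.
have /continuousP sv : continuous (@config_of G A X).
  exact: initial_continuous.
exact: (sv _ (pr [set u i] (discrete_open _))).
Qed.

Variables (mu : probability (borel X) R) (E : {fset G}).

Definition pattern_prob (F : {fset G}) (u : {ffun F -> A}) : R :=
  fine (mu (cylinder X u)).

Lemma pattern_prob_ge0 (u : {ffun E -> A}) : 0 <= pattern_prob u.
Proof. exact/fine_ge0. Qed.

Lemma probability_pattern_event (S : pred {ffun E -> A}) :
  fine (mu [set x | S (pattern E (config_of x))]) =
  \sum_(u | S u) pattern_prob u.
Proof.
have -> : [set x : borel X | S (pattern E (config_of x))] =
    \bigcup_(u in [set` enum S]) cylinder X u.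
  apply/seteqP; split => [x/= Sx|x [u Su xu]]; last first.
    by move: Su; rewrite /= mem_enum xu.
  by exists (pattern E (config_of x)) => //=; rewrite mem_enum.
rewrite measure_fin_bigcup//.
- rewrite -fsbig_seq ?enum_uniq//.
  rewrite big_enum /= -sum_fine//.
  by move=> u _; apply: fin_num_measure; exact: measurable_cylinder.
- by move=> u1 u2 _ _ [x [<- <-]].
- by move=> u _; exact: measurable_cylinder.
Qed.

Lemma pattern_prob_sum : \sum_(u : {ffun E -> A}) pattern_prob u = 1.
Proof.
rewrite -(probability_pattern_event predT).
by rewrite (_ : [set _ | _] = setT) ?probability_setT//; apply/seteqP.
Qed.

Lemma pattern_prob_notin (u : {ffun E -> A}) :
  u \notin language X E -> pattern_prob u = 0.
Proof.
move=> uX; rewrite /pattern_prob (_ : cylinder X u = set0) ?measure0//.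
apply/seteqP; split=> // x xu; move/negP: uX; apply; rewrite !inE.
by exists (config_of x) => //; exact: set_mem (valP x).
Qed.

Lemma pattern_sum_language (f : {ffun E -> A} -> R) :
  (forall u, u \notin language X E -> f u = 0) ->
  \sum_(u in language X E) f u = \sum_u f u.
Proof.
by move=> f0; rewrite [RHS](bigID [in language X E])/= [X in _ + X]big1 ?addr0.
Qed.

(** By invariance, [v] occurs at each interior position with the probability
    of its cylinder; it cannot occur at the other positions. *)
Lemma expected_occurrences (F : {fset G}) (v : {ffun F -> A}) :
    translation_invariant mu ->
  \sum_(u in language X E) pattern_prob u * #|occurrences v u|%:R =
  #|interior_set E F|%:R * pattern_prob v :> R.
Proof.
move=> mu_inv; rewrite pattern_sum_language; last first.
  by move=> u /pattern_prob_notin ->; rewrite mul0r.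
have cardE u : pattern_prob u * #|occurrences v u|%:R =
    \sum_(g in occurrences v u) pattern_prob u :> R.
  by rewrite sumr_const mulr_natr.
under eq_bigr do rewrite cardE.
rewrite (exchange_big_dep predT)//=.
under eq_bigr do rewrite -probability_pattern_event.
rewrite mulr_natl -sumr_const [RHS]big_mkcond/=; apply: eq_bigr => g _.
case: ifPn => [|gE].
  rewrite inE => /forallP gE; rewrite /pattern_prob.
  rewrite -(mu_inv (val g)^-1%g _ (measurable_cylinder v)); congr (fine (mu _)).
  apply/seteqP; split => x /=.
    move=> /occurrencesP occ; apply/ffunP => i; have [h hE <-] := occ i.
    by rewrite !ffunE hE config_translate invgK.
  move=> <-; apply/occurrencesP => i; exists [` gE i]%fset => //.
  by rewrite !ffunE config_translate invgK.
rewrite (_ : [set _ | _] = set0) ?measure0//; apply/seteqP; split => //= x.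
move=> /occurrencesP occ; move: gE; rewrite inE => /forallPn[i].
by have [h <- _] := occ i; rewrite fsvalP.
Qed.

End pattern_probability.

(** * Measures of maximal entropy *)

Section maximal_entropy.
Variables (R : realType) (G : groupType) (A : finType) (X : subshift G A).
Variables (mu : probability (borel X) R) (F : {fset G}) (v w : {ffun F -> A}).
Hypothesis vw : extender_set X v `<=` extender_set X w.

Lemma shannon_language (E : {fset G}) : shannon mu E =
  \sum_(u in language X E) - (pattern_prob mu u * ln (pattern_prob mu u)).
Proof.
rewrite (pattern_sum_language (X := X)) // => u /(pattern_prob_notin mu) ->.
by rewrite mul0r oppr0.
Qed.

Lemma shannon_excess_le (E : {fset G}) (t : R) :
    translation_invariant mu -> 0 <= t ->
  shannon mu E + t * (#|interior_set E F|%:R *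
                      (pattern_prob mu v - pattern_prob mu w)) <=
  ln #|language X E|%:R +
    t * (#|` E|%:R * (expR (t * ((#|` F| * #|` F|).*2)%:R) - 1)).
Proof.
move=> mu_inv t0; rewrite mulrBr -!(expected_occurrences E _ mu_inv) -sumrB.
under eq_bigr do rewrite -mulrBr.
rewrite shannon_language cardfE.
apply: (entropy_excess_le (exchange := fun u g => overwrite w (val g) u)) => //.
- by move=> u g; exact: overwrite_language.
- by move=> u g; exact: occurrences_overwrite.
- by move=> g u1 u2; exact: overwrite_inj.
- move=> u g _; apply: (@occurrences_card_le _ _ _ _ v _ _ (val g)) => h hF.
  by rewrite overwrite_out.
- move=> u g _; apply: (@occurrences_card_le _ _ _ _ w _ _ (val g)) => h hF.
  by rewrite overwrite_out.
- exact: pattern_prob_ge0.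
- rewrite (pattern_sum_language (X := X)) ?pattern_prob_sum//.
  exact: pattern_prob_notin.
Qed.

End maximal_entropy.

Theorem theorem4p4 (R : realType) (G : groupType) (A : finType)
    (G_countable : countable [set: G]) (G_amenable : amenable R G)
    (G_fg : finitely_generated G) (G_torsion_free : torsion_free G)
    (X : subshift G A) (mu : probability (borel X) R)
    (mu_max : maximal_entropy mu)
    (F : {fset G}) (v w : {ffun F -> A})
    (v_lang : v \in language X F) (w_lang : w \in language X F) :
  extender_set X v `<=` extender_set X w ->
  (mu (cylinder X v) <= mu (cylinder X w))%E.
Proof.
move=> vw; have [mu_inv [E [E_folner [h [mu_h X_h]]]]] := mu_max.
have finm (u : {ffun F -> A}) : mu (cylinder X u) \is a fin_num.
  by apply: fin_num_measure; exact: measurable_cylinder.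
rewrite -[leLHS]fineK// -[leRHS]fineK// lee_fin leNgt; apply/negP => wv.
pose eta := pattern_prob mu v - pattern_prob mu w.
have eta0 : 0 < eta by rewrite subr_gt0.
pose c : R := ((#|` F| * #|` F|).*2)%:R.
have c0 : 0 <= c by exact: ler0n.
(* Any positive t with exp(c t) - 1 < eta / 2 would do; the denominator is
   c + 1 because c is 0 when F is empty. *)
pose t := ln (1 + eta / 4) / (c + 1).
have t0 : 0 < t by rewrite divr_gt0 ?ln_gt0//; lra.
have small : expR (t * c) - 1 <= eta / 4.
  rewrite lerBlDl -[leRHS]lnK ?posrE; last lra.
  rewrite ler_expR -[leRHS](divfK (_ : c + 1 != 0)); last first.
    by rewrite gt_eqF; lra.
  by rewrite ler_wpM2l ?(ltW t0)//; lra.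
have gap0 : 0 < t * eta / 4 by have := mulr_gt0 t0 eta0; lra.
have : (#|` E n|%:R)^-1 * ln #|language X (E n)|%:R -
       (#|` E n|%:R)^-1 * shannon mu (E n) @[n --> \oo] --> (0 : R).
  by rewrite -(subrr h); exact: cvgB.
move=> /cvgrPdist_lt/(_ _ gap0) gap_small.
have [n [lt_gap le_int]] :=
  filter_ex (filterI gap_small (folner_interior F E_folner)).
have En : 0 < #|` E n|%:R :> R by rewrite ltr0n cardfs_gt0 E_folner.1.
have := shannon_excess_le vw (E n) mu_inv (ltW t0).
rewrite -/c -/eta; apply/negP; rewrite -ltNge.
move: lt_gap; rewrite sub0r normrN -mulrBr => /(le_lt_trans (ler_norm _)).
rewrite mulrC ltr_pdivrMr// => lt_gap.
have := ler_wpM2l (ltW (mulr_gt0 t0 En)) small.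
have := ler_wpM2r (ltW (mulr_gt0 t0 eta0)) le_int.
lra.
Qed.
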